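(* For all positive integers $n$ and non-negative integers $k$, we have $$\det_{0\le i,j\le n-1}\left(\mathcal P^+_{i+j+1}(0,k)\right)=\begin{cases} (-1)^{n_1\binom{k+1}{2}}(xy)^{(k+1)^2\binom{n_1}{2}}\,\dfrac{y^{(k+1)(n_1+1)}-x^{(k+1)(n_1+1)}}{y^{k+1}-x^{k+1}} & \text{if } n=n_1(k+1),\\[2mm] (-1)^{n_1\binom{k+1}{2}+\binom k2}(xy)^{(k+1)^2\binom{n_1}{2}+n_1k(k+1)}\,\dfrac{y^{(k+1)(n_1+1)}-x^{(k+1)(n_1+1)}}{y^{k+1}-x^{k+1}} & \text{if } n=n_1(k+1)+k,\\[2mm] 0 & \text{if } n\not\equiv 0,k \pmod{k+1},\end{cases}$$ where $n_1$ denotes a non-negative integer.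
   Context: $x,y$ are indeterminates. A three-step path is a lattice path in $\mathbb Z^2$ consisting of steps from $\{(1,0),(1,1),(1,-1)\}$. The steps have weights $w((1,0))=x+y$, $w((1,1))=1$, $w((1,-1))=xy$, and the weight $w(P)$ of a path $P$ is the product of the weights of its steps (the empty path has weight $1$). For integers $n\ge 0$ and $l,k\ge0$, $\mathcal P^+_n(l,k)=\sum_P w(P)$, where the sum is over all three-step paths $P$ from $(0,l)$ to $(n,k)$ which never run below the $x$-axis. For $k=0$ the formula is read with the convention that only the first case on the right-hand side applies. The quotients are to be read as polynomials in $x,y$. *)

(* Defs.v *)
From HB Require Import structures.
From mathcomp Require Export all_boot all_order all_algebra.
From mathcomp Require Export mpoly.

Set Implicit Arguments.
Unset Strict Implicit.
Unset Printing Implicit Defensive.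

Import GRing.Theory Num.Theory.
Local Open Scope ring_scope.

Notation "p %:F" := (@FracField.tofrac _ p) : ring_scope.

Notation Zxy := {mpoly int[2]}.

Definition x : Zxy := 'X_(ord0 : 'I_2).
Definition y : Zxy := 'X_(ord_max : 'I_2).

Inductive step := Level | Up | Down.

Definition option_of_step (s : step) : option bool :=
  match s with Level => None | Up => Some true | Down => Some false end.

Definition step_of_option (o : option bool) : step :=
  match o with None => Level | Some true => Up | Some false => Down end.

Lemma option_of_stepK : cancel option_of_step step_of_option.
Proof. by case. Qed.

HB.instance Definition _ := Finite.copy step (can_type option_of_stepK).

Definition step_vec (s : step) : int * int :=
  match s with Level => (1, 0) | Up => (1, 1) | Down => (1, -1) end.

Definition step_weight (s : step) : Zxy :=
  match s with Level => x + y | Up => 1 | Down => x * y end.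

(* A path is given by its starting point [a] and its sequence of steps [p]. *)
Definition step_from (v : int * int) (s : step) : int * int := v + step_vec s.

Definition vertices (a : int * int) (p : seq step) : seq (int * int) :=
  a :: scanl step_from a p.

Definition endpoint (a : int * int) (p : seq step) : int * int :=
  foldl step_from a p.

Definition never_below_axis (a : int * int) (p : seq step) : bool :=
  all (fun v => 0 <= v.2) (vertices a p).

Definition path_weight (p : seq step) : Zxy := \prod_(s <- p) step_weight s.

Lemma endpoint_abscissa (a : int * int) (p : seq step) :
  (endpoint a p).1 = a.1 + (size p)%:Z.
Proof.
elim: p a => [|s p IHp] a; first by rewrite addr0.
by rewrite [LHS]IHp /= intS addrA; case: s.
Qed.

(* By [endpoint_abscissa], a path from (0, l) to (n, k) has exactly n steps,
   so summing over n-tuples of steps loses no path. *)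
Definition Pplus (n l k : nat) : Zxy :=
  \sum_(p : n.-tuple step | (endpoint (0, l%:Z) p == (n%:Z, k%:Z))
                            && never_below_axis (0, l%:Z) p) path_weight p.

(* The quotient is taken in the field of fractions of Z[x, y]; equating it with
   the image of a polynomial includes the fact that it is a polynomial. *)
Definition quotient (k n1 : nat) : {fraction Zxy} :=
  (y ^+ (k.+1 * n1.+1) - x ^+ (k.+1 * n1.+1))%:F
    / (y ^+ k.+1 - x ^+ k.+1)%:F.

(* Main.v *)
(* Let u_0 = 0, u_1 = 1, u_(n+2) = (X - (x+y)) u_(n+1) - xy u_n, so that u_(n+1)
   is the n-th orthogonal polynomial attached to the three-step paths, and let
   L_k be the linear functional X^i |-> P^+_i(0,k).  Then
   L_0(u_(k+1) f) = (xy)^k L_k(f), and L_j is 0 in degree < j and 1 on monic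
   polynomials of degree j.  Since u is a divisibility sequence,
   p = u_((N+1)(k+1)) / u_(k+1) is a monic polynomial of degree m = N(k+1), and
   L_k(p f) = (xy)^m L_(m+k)(f): p is orthogonal for L_k to all degrees < m + k.
   Replacing X^(m+s) by X^s p in the monomial basis therefore splits the Hankel
   matrix of size m + r into the one of size m and an r x r block that is
   antitriangular.  When m equals the size, p also expresses multiplication by X
   as a companion matrix of p, so that shifting the moments by one multiplies
   the Hankel determinant by (-1)^m p(0), which is the quotient in x and y. *)
From HB Require Import structures.
Require Import Defs.
From mathcomp Require Import all_boot all_order all_algebra ring zify.
From mathcomp Require Import mpoly.

Set Implicit Arguments.
Unset Strict Implicit.
Unset Printing Implicit Defensive.

Import GRing.Theory.
Local Open Scope ring_scope.

(** * Hankel determinants of a linear functional *)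

Section Hankel.
Variables (R : comNzRingType) (phi : {scalar {poly R}}).
Implicit Types (w p : {poly R}) (m n r : nat).

(** The weight [w] covers plain moments ([1]), shifted moments (['X]) and the block split off by [p]
    ([w * p ^+ 2]). *)
Definition hankel w n : R :=
  \det (\matrix_(i < n, j < n) phi (w * 'X^(i + j))).

Lemma poly_sum_coef p n : (size p <= n)%N -> p = \sum_(i < n) p`_i *: 'X^i.
Proof.
move=> le_pn; rewrite -[in LHS](coefK p) poly_def.
rewrite [RHS](bigID (fun i : 'I_n => (i < size p)%N)) /=.
rewrite [X in _ + X]big1 ?addr0 => [|i]; last first.
  by rewrite -leqNgt => /(nth_default 0) ->; rewrite scale0r.
by rewrite [RHS](big_ord_narrow le_pn).
Qed.

(** The change of basis [B] is unitriangular, so the determinant does not change. *)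
Lemma gram_hankel w (b : nat -> {poly R}) n :
  (forall i, b i \is monic) -> (forall i, size (b i) = i.+1) ->
  \det (\matrix_(i < n, j < n) phi (w * (b i * b j))) = hankel w n.
Proof.
move=> b_monic size_b.
pose B := \matrix_(i < n, j < n) (b i)`_j.
have detB : \det B = 1.
  rewrite det_trig; last first.
    by apply/is_trig_mxP => i j lt_ij; rewrite mxE nth_default // size_b.
  rewrite big1 // => i _; rewrite mxE.
  by have /monicP := b_monic i; rewrite lead_coefE size_b.
rewrite /hankel; set H := (X in _ = \det X).
suff -> : \matrix_(i, j) phi (w * (b i * b j)) = B *m H *m B^T.
  by rewrite !det_mulmx det_tr detB mul1r mulr1.
have expand (i : 'I_n) : b i = \sum_(l < n) (b i)`_l *: 'X^l.
  by apply: poly_sum_coef; rewrite size_b.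
apply/matrixP => i j; rewrite [RHS]mxE mxE.
rewrite [b j]expand !mulr_sumr linear_sum; apply: eq_bigr => l _.
rewrite -!scalerAr linearZ [RHS]mulrC !mxE; congr (_ * _).
rewrite [b i]expand mulr_suml mulr_sumr linear_sum; apply: eq_bigr => t _.
by rewrite -scalerAl -scalerAr linearZ !mxE exprD mulrA.
Qed.

Lemma hankel_split w p m r : p \is monic -> size p = m.+1 ->
  (forall i, (i.+1 < m + r)%N -> phi (w * p * 'X^i) = 0) ->
  hankel w (m + r) = hankel w m * hankel (w * p ^+ 2) r.
Proof.
move=> p_monic size_p ortho.
(* In this basis the off-diagonal blocks have entries [phi (w * p * 'X^s)] with [s <= m + r - 2],
   which vanish by [ortho]. *)
pose b i := if (i < m)%N then 'X^i else p * 'X^(i - m).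
have b_monic i : b i \is monic.
  by rewrite /b; case: ifP => _; rewrite ?monicMl // monicXn.
have size_b i : size (b i) = i.+1.
  rewrite /b; case: ltnP => [_|le_mi]; first by rewrite size_polyXn.
  by rewrite size_Mmonic ?monicXn ?monic_neq0 // size_p size_polyXn; lia.
rewrite -(gram_hankel w _ b_monic size_b).
set A := \matrix_(i, j) _.
have -> : A = block_mx (\matrix_(i < m, j < m) phi (w * 'X^(i + j))) 0 0
                (\matrix_(i < r, j < r) phi (w * p ^+ 2 * 'X^(i + j))).
  apply/matrixP => i j; rewrite mxE.
  case: (split_ordP i) => i' ->; case: (split_ordP j) => j' ->.
  - by rewrite block_mxEul mxE /b /= !ltn_ord exprD.
  - rewrite block_mxEur mxE /b /= ltn_ord ltnNge leq_addr /= addKn.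
    rewrite -[RHS](ortho (i' + j')%N); last first.
      by have := ltn_ord i'; have := ltn_ord j'; lia.
    by congr (phi _); rewrite exprD; ring.
  - rewrite block_mxEdl mxE /b /= ltn_ord ltnNge leq_addr /= addKn.
    rewrite -[RHS](ortho (i' + j')%N); last first.
      by have := ltn_ord i'; have := ltn_ord j'; lia.
    by congr (phi _); rewrite exprD; ring.
  - rewrite block_mxEdr mxE /b /= !ltnNge !leq_addr /= !addKn.
    by congr (phi _); rewrite exprD; ring.
by rewrite det_ublock.
Qed.

Lemma det_antidiagonal (g : nat -> R) r :
  (forall s, (s.+1 < r)%N -> g s = 0) ->
  \det (\matrix_(i < r, j < r) g (i + j)%N) = (-1) ^+ 'C(r, 2) * g r.-1 ^+ r.
Proof.
elim: r g => [|r IHr] g g0; first by rewrite det_mx00 mulr1.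
(* In the first row only the last entry survives; its minor has the same shape, with [g] shifted by
   one. *)
rewrite (expand_det_row _ ord0) (bigD1 ord_max) //= big1 ?addr0; last first.
  move=> j ne_j; rewrite mxE add0n g0 ?mul0r //.
  by rewrite ltnS ltn_neqAle -ltnS ltn_ord andbT.
rewrite mxE add0n /cofactor add0n binS bin1 exprD exprS.
have -> : row' ord0 (col' ord_max (\matrix_(i < r.+1, j < r.+1) g (i + j)%N))
          = \matrix_(i < r, j < r) g (i + j).+1.
  apply/matrixP => i j; rewrite !mxE /= /bump /=.
  by rewrite [(r <= j)%N]leqNgt ltn_ord.
rewrite (IHr (fun s => g s.+1)) => [|s lt_sr]; last exact: g0.
(* For [r = 0] the truncated [r.-1] gives another argument of [g], but the exponent there is 0. *)
by case: r {IHr g0} => [|r] /=; rewrite ?expr0; ring.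
Qed.

(** Reducing ['X^n] by [p] makes the shifted matrix [companionmx p] times the unshifted one. The
    determinant of [companionmx p] is, up to sign, the constant coefficient of its characteristic
    polynomial [p]. *)
Lemma hankel_christoffel w p n : p \is monic -> size p = n.+1 ->
  (forall i, (i < n)%N -> phi (w * p * 'X^i) = 0) ->
  hankel ('X * w) n = (-1) ^+ n * p.[0] * hankel w n.
Proof.
move=> p_monic size_p ortho; have En : n = (size p).-1 by rewrite size_p.
have detC : \det (companionmx p) = (-1) ^+ n * p.[0].
  have /(congr1 (fun q : {poly R} => q`_0)) := companionmxK p_monic.
  rewrite char_poly_det; move: (\det _) => d; rewrite -En horner_coef0 => <-.
  by rewrite mulrA -exprD addnn -mul2n exprM sqrrN expr1n expr1n mul1r.
have top j : (j < n)%N ->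
    phi ('X * w * 'X^(n.-1 + j)) = \sum_(l < n) - p`_l * phi (w * 'X^(l + j)).
  move=> lt_jn; have := ortho j lt_jn.
  rewrite {1}(@poly_sum_coef p n.+1) ?size_p // mulr_sumr mulr_suml linear_sum.
  have -> : phi ('X * w * 'X^(n.-1 + j)) = phi (w * 'X^(n + j)).
    case: n lt_jn {En ortho size_p detC} => // n' _.
    by rewrite addSn /= exprS mulrCA mulrA.
  rewrite big_ord_recr /=.
  have -> : p`_n = 1 by rewrite -(monicP p_monic) lead_coefE size_p.
  rewrite scale1r -mulrA -exprD addrC => /eqP; rewrite addr_eq0 => /eqP ->.
  rewrite -sumrN; apply: eq_bigr => l _.
  by rewrite -scalerAr -scalerAl linearZ /= -mulrA -exprD mulNr.
rewrite -detC /hankel {detC}; move: ortho top; rewrite En => ortho top.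
rewrite -det_mulmx; congr (\det _); apply/matrixP => i j; rewrite !mxE.
have [lt_i|ge_i] := ltnP i.+1 (size p).-1.
  have ne_i : (i == (size p).-1.-1 :> nat) = false by lia.
  rewrite (bigD1 (Ordinal lt_i)) //= big1 ?addr0 => [|l ne_l].
    by rewrite !mxE ne_i /= eqxx mul1r addSn exprS mulrCA mulrA.
  rewrite !mxE ne_i.
  by move: ne_l; rewrite eq_sym -val_eqE /= => /negPf ->; rewrite mul0r.
have Ei : nat_of_ord i = (size p).-1.-1 by have := ltn_ord i; lia.
by rewrite Ei top //; apply: eq_bigr => l _; rewrite !mxE Ei eqxx.
Qed.
End Hankel.

(** * The linear functional with given moments *)

Section MomentFunctional.
Variable R : comNzRingType.

Definition moment_functional (a : nat -> R) (f : {poly R}) : R :=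
  \sum_(i < size f) f`_i * a i.

Lemma moment_functionalE a (f : {poly R}) n : (size f <= n)%N ->
  moment_functional a f = \sum_(i < n) f`_i * a i.
Proof.
move=> le_fn; rewrite [RHS](bigID (fun i : 'I_n => (i < size f)%N)) /=.
rewrite [X in _ + X]big1 ?addr0 => [|i]; last first.
  by rewrite -leqNgt => /(nth_default 0) ->; rewrite mul0r.
by rewrite [RHS](big_ord_narrow le_fn).
Qed.

Fact moment_functional_is_linear a : scalar (moment_functional a).
Proof.
move=> c f g; pose n := maxn (size f) (size g).
rewrite !(@moment_functionalE a _ n) ?leq_maxl ?leq_maxr //; last first.
  rewrite (leq_trans (size_polyD _ _)) // geq_max leq_maxr andbT.
  by rewrite (leq_trans (size_scale_leq _ _)) ?leq_maxl.
rewrite mulr_sumr -big_split; apply: eq_bigr => i _ /=.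
by rewrite coefD coefZ mulrDl mulrA.
Qed.

HB.instance Definition _ a :=
  GRing.isLinear.Build R {poly R} R *%R (moment_functional a)
    (moment_functional_is_linear a).

Lemma moment_functionalXn a n : moment_functional a 'X^n = a n.
Proof.
rewrite /moment_functional size_polyXn big_ord_recr big1 /= => [|i _].
  by rewrite add0r coefXn eqxx mul1r.
by rewrite coefXn ltn_eqF // mul0r.
Qed.

Lemma moment_functionalMX a (f : {poly R}) :
  moment_functional a ('X * f) = moment_functional (fun i => a i.+1) f.
Proof.
rewrite (@moment_functionalE a _ (size f).+1); last first.
  by rewrite (leq_trans (size_polyMleq _ _)) // size_polyX.
rewrite big_ord_recl coefXM mul0r add0r; apply: eq_bigr => i _.
by rewrite coefXM.
Qed.

End MomentFunctional.

(** * Orthogonal polynomials and the path functionals *)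

Section ShiftedChebyshev.
Variables (R : idomainType) (b q : R).

(* [ortho_poly n.+1] has degree n and [ortho_poly 0 = 0]; this indexing makes
   [n |-> ortho_poly n] a divisibility sequence. *)
Fixpoint ortho_poly (n : nat) : {poly R} :=
  match n with
  | 0 => 0
  | m.+1 => if m is l.+1 then ('X - b%:P) * ortho_poly m - q *: ortho_poly l
            else 1
  end.

Arguments ortho_poly : simpl never.

Lemma ortho_polySS n :
  ortho_poly n.+2 = ('X - b%:P) * ortho_poly n.+1 - q *: ortho_poly n.
Proof. by []. Qed.

Lemma ortho_poly_monic_size n :
  ortho_poly n.+1 \is monic /\ size (ortho_poly n.+1) = n.+1.
Proof.
elim/ltn_ind: n => -[_|n IHn]; first by rewrite monic1 size_poly1.
have [monic_n size_n] := IHn n (leqnn _).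
have sizeM : size (('X - b%:P) * ortho_poly n.+1) = n.+2.
  by rewrite size_monicM ?monicXsubC ?monic_neq0 // size_XsubC size_n.
have lt_size : (size (- (q *: ortho_poly n))%R
      < size (('X - b%:P) * ortho_poly n.+1)%R)%N.
  rewrite sizeM size_polyN (leq_ltn_trans (size_scale_leq _ _)) //.
  case: n IHn {monic_n size_n sizeM} => [|n] IHn; first by rewrite size_poly0.
  by rewrite (IHn n _).2 // ltnS leqW.
rewrite ortho_polySS size_polyDl // sizeM monicE lead_coefDl //.
by rewrite -monicE monicMl ?monicXsubC.
Qed.

(** Addition formula of Chebyshev type; the induction moves one unit of index from [m] to [n]. *)
Lemma ortho_polyD m n : ortho_poly (m + n).+1 =
  ortho_poly m.+1 * ortho_poly n.+1 - q *: (ortho_poly m * ortho_poly n).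
Proof.
elim: m n => [|m IHm] n; first by rewrite mul1r mul0r scaler0 subr0.
rewrite addSnnS IHm !ortho_polySS -!mul_polyC; ring.
Qed.

Lemma ortho_poly_dvd k N :
  {p | ortho_poly (N * k.+1) = ortho_poly k.+1 * p}.
Proof.
elim: N => [|N [p IHN]]; first by exists 0; rewrite mulr0.
(* The addition formula at [N * k.+1] and [k] has two terms, both with the factor [ortho_poly k.+1],
   the second by induction. *)
exists (ortho_poly (N * k.+1).+1 - q *: (p * ortho_poly k)).
by rewrite mulSnr addnS ortho_polyD IHN -!mul_polyC; ring.
Qed.

Lemma ortho_poly_quotient k N :
  {p | [/\ ortho_poly (N.+1 * k.+1) = ortho_poly k.+1 * p, p \is monic
         & size p = (N * k.+1).+1]}.
Proof.
have [p Ep] := ortho_poly_dvd k N.+1; exists p.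
have [monic_k size_k] := ortho_poly_monic_size k.
have := ortho_poly_monic_size (N * k.+1 + k).
rewrite -addnS -mulSnr Ep monicMl // => -[monic_p].
by rewrite size_monicM ?monic_neq0 // size_k => size_p; split=> //; lia.
Qed.

(** [a n k] abstracts the path sum from height 0 to height [k] in [n] steps; the hypotheses remove
    the last step. *)
Variable a : nat -> nat -> R.
Hypothesis a0 : forall k, a 0 k = (k == 0)%:R.
Hypothesis aS0 : forall n, a n.+1 0 = b * a n 0 + q * a n 1.
Hypothesis aSS :
  forall n k, a n.+1 k.+1 = a n k + b * a n k.+1 + q * a n k.+2.

Let L k : {scalar {poly R}} := moment_functional (a^~ k).

Lemma L_recr0 f : L 0 (('X - b%:P) * f) = q * L 1 f.
Proof.
rewrite mulrBl linearB mul_polyC linearZ /= moment_functionalMX.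
rewrite /moment_functional !mulr_sumr -sumrB; apply: eq_bigr => i _.
by rewrite aS0; ring.
Qed.

Lemma L_recrS k f : L k.+1 (('X - b%:P) * f) = L k f + q * L k.+2 f.
Proof.
rewrite mulrBl linearB mul_polyC linearZ /= moment_functionalMX.
rewrite /moment_functional !mulr_sumr -sumrB -big_split; apply: eq_bigr => i _.
by rewrite aSS /=; ring.
Qed.

Lemma L0_ortho_poly n f : L 0 (ortho_poly n.+1 * f) = q ^+ n * L n f.
Proof.
elim/ltn_ind: n f => -[_|[_|n IHn]] f; first by rewrite !mul1r.
  by rewrite ortho_polySS scaler0 subr0 mulr1 L_recr0 expr1.
(* The two contributions of [L n f] cancel and leave [q ^+ n.+2 * L n.+2 f]. *)
rewrite ortho_polySS mulrBl linearB -scalerAl linearZ /= -mulrA (mulrCA ('X - _)).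
rewrite (IHn n.+1) // (IHn n) // L_recrS /L /= !exprS; ring.
Qed.

(** Multiplied by [q ^+ k], both sides equal [L 0 (ortho_poly (m + k).+1 * f)]. *)
Lemma L_quotient k m p f : q != 0 ->
  ortho_poly (m + k).+1 = ortho_poly k.+1 * p ->
  L k (p * f) = q ^+ m * L (m + k) f.
Proof.
move=> q_neq0 Ep; apply: (mulfI (expf_neq0 k q_neq0)).
by rewrite -L0_ortho_poly mulrA -Ep L0_ortho_poly mulrA -exprD addnC.
Qed.

(** In terms of paths: [i] steps climb at most to height [i], and reach it only by up steps, of
    weight 1. *)
Lemma moment_triangular i k : (i <= k)%N -> a i k = (i == k)%:R.
Proof.
elim: i k => [|i IHi] [|k] // le_ik; rewrite ?a0 // aSS !IHi ?leqW //.
have -> : (i == k.+1) = false by lia.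
have -> : (i == k.+2) = false by lia.
by rewrite !mulr0 !addr0 eqSS.
Qed.

Lemma L_coef k (f : {poly R}) : (size f <= k.+1)%N -> L k f = f`_k.
Proof.
move=> le_fk; rewrite /L /= (moment_functionalE _ le_fk) big_ord_recr big1 /=.
  by rewrite add0r moment_triangular // eqxx mulr1.
by move=> i _; rewrite moment_triangular ?ltn_eqF ?mulr0 // ltnW.
Qed.

Hypothesis q_neq0 : q != 0.

Lemma L_quotient_orthogonal k m p i :
  ortho_poly (m + k).+1 = ortho_poly k.+1 * p -> (i < m + k)%N ->
  L k (p * 'X^i) = 0.
Proof.
move=> Ep lt_i; rewrite (L_quotient _ q_neq0 Ep) /L /= moment_functionalXn.
by rewrite moment_triangular ?ltn_eqF ?mulr0 // ltnW.
Qed.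

(** One factor [p] turns [L k] into [q ^+ m * L (m + k)], which reads the coefficient of degree
    [m + k] in [p * 'X^i]. *)
Lemma L_quotient_sqr k m p i :
  ortho_poly (m + k).+1 = ortho_poly k.+1 * p -> p \is monic ->
  size p = m.+1 -> (i <= k)%N -> L k (p ^+ 2 * 'X^i) = q ^+ m * (i == k)%:R.
Proof.
move=> Ep monic_p size_p le_ik.
rewrite expr2 -mulrA (L_quotient _ q_neq0 Ep); congr (_ * _).
rewrite L_coef; last first.
  by rewrite size_Mmonic ?monicXn ?monic_neq0 // size_p size_polyXn; lia.
rewrite coefMXn ltnNge; have -> /= : (i <= m + k)%N by lia.
have [->|ne_ik] := eqVneq i k.
  by rewrite addnK -[RHS](monicP monic_p) lead_coefE size_p.
by rewrite nth_default // size_p; lia.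
Qed.

Section HankelOfL.
Variables k N : nat.
Let m := (N * k.+1)%N.

(** Used with [e = 0] for plain and [e = 1] for shifted moments; the bound on [e + r] keeps all
    exponents below [m + k], where [p] is orthogonal. *)
Lemma hankel_L_split e r : (e + r <= k.+1)%N ->
  {g | hankel (L k) 'X^e (m + r)
         = hankel (L k) 'X^e m * \det (\matrix_(i < r, j < r) g (i + j)%N)
     & forall i, (e + i <= k)%N -> g i = q ^+ m * (e + i == k)%:R}.
Proof.
move=> le_er; have [p [Ep monic_p size_p]] := ortho_poly_quotient k N.
rewrite mulSnr addnS in Ep.
exists (fun i => L k ('X^e * p ^+ 2 * 'X^i)) => [|i le_ei].
  rewrite (hankel_split monic_p size_p) // => i lt_i.
  by rewrite mulrAC mulrC -exprD; apply: L_quotient_orthogonal Ep _; lia.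
rewrite mulrAC mulrC -exprD; exact: L_quotient_sqr Ep monic_p size_p le_ei.
Qed.

(** The antidiagonal of the block falls on [e + i = k], where [g i] is [q ^+ m]. *)
Lemma hankel_L_step e r : (e + r)%N = k.+1 ->
  hankel (L k) 'X^e (m + r)
    = hankel (L k) 'X^e m * ((-1) ^+ 'C(r, 2) * q ^+ (m * r)).
Proof.
move=> Er; have [|g -> gE] := @hankel_L_split e r; first by rewrite Er.
rewrite det_antidiagonal => [|s lt_sr]; last first.
  by rewrite gE ?ltn_eqF ?mulr0 //; lia.
case: r Er => [|r] Er; first by rewrite muln0 !expr0.
rewrite gE /=; last by lia.
have -> : (e + r == k)%N by lia.
by rewrite mulr1 exprM.
Qed.

(** The first row of the block stays at [e + j < k], where [g] vanishes. *)
Lemma hankel_L_gap e r : (0 < r)%N -> (e + r <= k)%N ->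
  hankel (L k) 'X^e (m + r) = 0.
Proof.
move=> r_gt0 le_erk; have [|g -> gE] := @hankel_L_split e r; first exact: leqW.
rewrite (expand_det_row _ (Ordinal r_gt0)) big1 ?mulr0 // => j _.
rewrite mxE /= gE; last by have := ltn_ord j; lia.
by rewrite ltn_eqF ?mulr0 ?mul0r //; have := ltn_ord j; lia.
Qed.

End HankelOfL.

Lemma hankel_L1 k N : hankel (L k) 1 (N * k.+1)
  = (-1) ^+ (N * 'C(k.+1, 2)) * q ^+ (k.+1 ^ 2 * 'C(N, 2)).
Proof.
elim: N => [|N IHN]; first by rewrite /hankel det_mx00 muln0 !expr0 mulr1.
rewrite mulSnr (@hankel_L_step k N 0) ?add0n // IHN (binS N) bin1.
have -> : (k.+1 ^ 2 * ('C(N, 2) + N) = k.+1 ^ 2 * 'C(N, 2) + N * k.+1 * k.+1)%N.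
  by ring.
by rewrite mulSn !exprD; ring.
Qed.

End ShiftedChebyshev.

(** * Values at zero and the determinants in [x] and [y] *)

Section TwoParameters.
Variables (R : idomainType) (x y : R).
Local Notation ortho_poly := (ortho_poly (x + y) (x * y)).

(** Binet formula: at ['X = 0] the recurrence has characteristic roots [- x] and [- y]. *)
Lemma ortho_poly_horner0 n :
  (ortho_poly n).[0] * (y - x) = (- x) ^+ n - (- y) ^+ n.
Proof.
elim/ltn_ind: n => -[_|[_|n IHn]]; first by rewrite horner0 !expr0; ring.
  by rewrite hornerC !expr1; ring.
rewrite ortho_polySS !hornerE mulrBl -!mulrA !IHn // !exprS; ring.
Qed.

Hypothesis xy_neq0 : x * y != 0.
Variable a : nat -> nat -> R.
Hypothesis a0 : forall k, a 0 k = (k == 0)%:R.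
Hypothesis aS0 : forall n, a n.+1 0 = (x + y) * a n 0 + x * y * a n 1.
Hypothesis aSS :
  forall n k, a n.+1 k.+1 = a n k + (x + y) * a n k.+1 + x * y * a n k.+2.

Let D k n := \det (\matrix_(i < n, j < n) a (i + j + 1) k).

Lemma D_hankel k n : D k n = hankel (moment_functional (a^~ k)) 'X^1 n.
Proof.
congr (\det _); apply/matrixP => i j.
by rewrite !mxE -exprD /= moment_functionalXn add1n addn1.
Qed.

Lemma det_multiple k N :
  D k (N * k.+1) * (y ^+ k.+1 - x ^+ k.+1)
    = (-1) ^+ (N * 'C(k.+1, 2)) * (x * y) ^+ (k.+1 ^ 2 * 'C(N, 2))
      * (y ^+ (k.+1 * N.+1) - x ^+ (k.+1 * N.+1)).
Proof.
have [p [Ep monic_p size_p]] := ortho_poly_quotient (x + y) (x * y) k N.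
rewrite D_hankel expr1 -['X]mulr1 (hankel_christoffel monic_p size_p); last first.
  move=> i lt_i; rewrite mul1r.
  apply: (L_quotient_orthogonal a0 aS0 aSS xy_neq0 (m := N * k.+1)); last by lia.
  by rewrite -addnS -mulSnr.
rewrite (hankel_L1 a0 aS0 aSS xy_neq0); set c := _ * (x * y) ^+ _.
have sgnK (s : nat) : (-1) ^+ s * (-1) ^+ s = 1 :> R.
  by rewrite -exprMn mulrNN mulr1 expr1n.
(* [p.[0]] relates two values given by the Binet formula; what follows only moves signs. *)
have p0 : p.[0] * ((- x) ^+ k.+1 - (- y) ^+ k.+1)
          = (- x) ^+ (N.+1 * k.+1) - (- y) ^+ (N.+1 * k.+1).
  by rewrite -!ortho_poly_horner0 Ep hornerM; ring.
have {p0} <- : (-1) ^+ (N * k.+1) * p.[0] * (y ^+ k.+1 - x ^+ k.+1)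
          = y ^+ (k.+1 * N.+1) - x ^+ (k.+1 * N.+1).
  move: p0; rewrite mulnC mulnS [(k.+1 * N)%N]mulnC.
  rewrite !(exprNn x) !(exprNn y) (exprD (-1)) -!mulrA.
  move: (sgnK k.+1) (sgnK (N * k.+1)%N).
  set s := _ ^+ k.+1; set t := _ ^+ (N * k.+1) => ss tt p0.
  transitivity (- (t * s) * (p.[0] * (s * x ^+ k.+1 - s * y ^+ k.+1))).
    by rewrite -[LHS]mul1r -ss; ring.
  set z := _ - x ^+ _; transitivity (s * s * (t * t) * z).
    by rewrite p0 /z; ring.
  by rewrite ss tt !mul1r.
by ring.
Qed.

(** The shift takes up one degree ([e = 1]), so the antitriangular block has size [k]. *)
Lemma det_step k N : (0 < k)%N ->
  D k (N * k.+1 + k)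
    = D k (N * k.+1) * ((-1) ^+ 'C(k, 2) * (x * y) ^+ (N * k * k.+1)).
Proof.
move=> k_gt0; rewrite !D_hankel (hankel_L_step a0 aS0 aSS xy_neq0) ?add1n //.
by rewrite mulnAC.
Qed.

Lemma det_gap k n : n != 0 %[mod k.+1] -> n != k %[mod k.+1] -> D k n = 0.
Proof.
move=> n_neq0 n_neqk; rewrite D_hankel (divn_eq n k.+1).
have lt_r := ltn_pmod n (ltn0Sn k).
rewrite mod0n (modn_small (leqnn k.+1)) in n_neq0 n_neqk.
(* The remainder lies strictly between 0 and [k]. *)
by apply: (hankel_L_gap a0 aS0 aSS xy_neq0); lia.
Qed.

End TwoParameters.

(** * Path sums and removal of the last step *)

Section ThreeStepPaths.

Lemma sum_tuple_rcons (M : nmodType) (T : finType) n (P : pred (seq T))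
    (F : seq T -> M) :
  \sum_(p : n.+1.-tuple T | P p) F p
    = \sum_(s : T) \sum_(p : n.-tuple T | P (rcons p s)) F (rcons p s).
Proof.
pose h (u : T * n.-tuple T) : n.+1.-tuple T := [tuple of rcons u.2 u.1].
have h_inj : injective h.
  by move=> [s p] [s' p'] /(congr1 (@tval _ _)) /rcons_inj [/val_inj -> ->].
have h_bij : bijective h.
  by apply: inj_card_bij h_inj _; rewrite card_prod !card_tuple expnS.
rewrite (reindex h) /=; last exact: onW_bij.
by rewrite pair_big_dep.
Qed.

Lemma endpoint_rcons a p s : endpoint a (rcons p s) = endpoint a p + step_vec s.
Proof. by rewrite /endpoint foldl_rcons. Qed.

Lemma never_below_axis_rcons a p s : never_below_axis a (rcons p s)
  = never_below_axis a p && (0 <= (endpoint a (rcons p s)).2).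
Proof.
by rewrite /never_below_axis /vertices scanl_rcons -rcons_cons all_rcons andbC.
Qed.

Lemma never_below_axis_endpoint a p :
  never_below_axis a p -> 0 <= (endpoint a p).2.
Proof.
case/lastP: p => [/andP[]//|p s]; by rewrite never_below_axis_rcons => /andP[].
Qed.

Lemma path_weight_rcons p s :
  path_weight (rcons p s) = path_weight p * step_weight s.
Proof. by rewrite /path_weight big_rcons /= mulrC. Qed.

Lemma big_step (M : nmodType) (F : step -> M) :
  \sum_(s : step) F s = F Up + F Level + F Down.
Proof.
rewrite (bigD1 Up) // (bigD1 Level) // (bigD1 Down) // big1 /=.
  by rewrite addr0 !addrA.
by case.
Qed.

Lemma Pplus0 l k : Pplus 0 l k = (l == k)%:R.
Proof.
rewrite /Pplus (eq_bigl (fun=> l == k)) => [|p]; last first.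
  by rewrite (tuple0 p) /endpoint /never_below_axis /= xpair_eqE !andbT.
have [_|_] := eqVneq l k; last by rewrite big_pred0.
rewrite (big_pred1 [tuple]) => [|p]; last exact/esym/eqP/tuple0.
by rewrite /path_weight big_nil.
Qed.

(** The endpoint has height [k >= 0], so the axis condition only concerns the path without its last
    step. *)
Lemma last_step_cond (a : int * int) n k p s :
  (endpoint a (rcons p s) == (n.+1%:Z, k%:Z)) && never_below_axis a (rcons p s)
  = (endpoint a p == (n%:Z, k%:Z - (step_vec s).2)) && never_below_axis a p.
Proof.
have -> : (n%:Z, k%:Z - (step_vec s).2) = (n.+1%:Z, k%:Z) - step_vec s.
  by congr pair; case: s; rewrite /= -addn1 PoszD addrK.
rewrite [in RHS]eq_sym subr_eq [in RHS]eq_sym never_below_axis_rcons endpoint_rcons.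
by case: eqP => // ->; rewrite andbT.
Qed.

Lemma PplusS n l k : Pplus n.+1 l k =
  (if k is k'.+1 then Pplus n l k' else 0) + (x + y) * Pplus n l k
  + x * y * Pplus n l k.+1.
Proof.
pose P := fun p : seq step => (endpoint (0, l%:Z) p == (n.+1%:Z, k%:Z))
  && never_below_axis (0, l%:Z) p.
rewrite /Pplus (sum_tuple_rcons _ P) big_step /P.
under eq_bigl => p do rewrite last_step_cond.
under [X in _ + X + _]eq_bigl => p do rewrite last_step_cond.
under [X in _ + X]eq_bigl => p do rewrite last_step_cond.
rewrite !mulr_sumr /= subr0 opprK -PoszD addn1.
congr (_ + _ + _); try by apply: eq_bigr => p _; rewrite path_weight_rcons mulrC.
case: k {P} => [|k].
  (* An up step ending at height 0 would start at height -1. *)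
  rewrite big_pred0 // => p; apply/andP=> -[/eqP Ep /never_below_axis_endpoint].
  by rewrite Ep.
rewrite -[k.+1]addn1 PoszD addrK.
by apply: eq_bigr => p _; rewrite path_weight_rcons mulr1.
Qed.

End ThreeStepPaths.

(** * Nonvanishing by evaluation, and passage to fractions *)

Lemma mpoly_neq0 (v : 'I_2 -> int) (p : Zxy) : p.@[v] != 0 -> p != 0.
Proof. by apply: contra_neq => ->; rewrite meval0. Qed.

Lemma xy_neq0 : x * y != 0.
Proof. by apply: mulf_neq0; apply: (@mpoly_neq0 (fun=> 1)); rewrite mevalXU. Qed.

Lemma y_exp_sub_x_exp_neq0 k : y ^+ k.+1 - x ^+ k.+1 != 0.
Proof.
(* Evaluation at [x = 0], [y = 1]. *)
apply: (@mpoly_neq0 (fun i => (i == ord_max)%:R)).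
by rewrite mevalB !rmorphXn /= !mevalXU expr1n expr0n.
Qed.

Lemma quotient_eq k n1 (D c : Zxy) :
  D * (y ^+ k.+1 - x ^+ k.+1)
    = c * (y ^+ (k.+1 * n1.+1) - x ^+ (k.+1 * n1.+1)) ->
  D%:F = c%:F * quotient k n1.
Proof.
move=> ED; rewrite /quotient mulrA; apply/eqP; rewrite eq_sym.
by rewrite -tofracM -ED tofracM mulfK // tofrac_eq0 y_exp_sub_x_exp_neq0.
Qed.

Theorem theorem2 (n k : nat) (n_gt0 : (0 < n)%N) :
  let D : Zxy := \det (\matrix_(i < n, j < n) Pplus (i + j + 1) 0 k) in
  [/\ (forall n1 : nat, n = (n1 * k.+1)%N ->
         D%:F = ((-1) ^+ (n1 * 'C(k.+1, 2))
                 * (x * y) ^+ (k.+1 ^ 2 * 'C(n1, 2)))%:F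
                * quotient k n1),
      (forall n1 : nat, (0 < k)%N -> n = (n1 * k.+1 + k)%N ->
         D%:F = ((-1) ^+ (n1 * 'C(k.+1, 2) + 'C(k, 2))
                 * (x * y) ^+ (k.+1 ^ 2 * 'C(n1, 2) + n1 * k * k.+1))%:F
                * quotient k n1)
    & (n != 0 %[mod k.+1] -> n != k %[mod k.+1] -> D = 0)].
Proof.
move=> D; pose a n k := Pplus n 0 k.
have a0 j : a 0 j = (j == 0)%:R by rewrite /a Pplus0 eq_sym.
have aS0 i : a i.+1 0 = (x + y) * a i 0 + x * y * a i 1.
  by rewrite /a PplusS add0r.
have aSS i j : a i.+1 j.+1 = a i j + (x + y) * a i j.+1 + x * y * a i j.+2.
  exact: PplusS.
split=> [n1 En|n1 k_gt0 En|].
- apply: quotient_eq; rewrite /D En; exact: (det_multiple xy_neq0 a0 aS0 aSS).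
- apply: quotient_eq; rewrite /D En (det_step xy_neq0 a0 aS0 aSS _ k_gt0).
  by rewrite mulrAC (det_multiple xy_neq0 a0 aS0 aSS) !exprD; ring.
- exact: (det_gap xy_neq0 a0 aS0 aSS).
Qed.
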